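(* For a linear subspace $W\subset\mathbb{R}^n$, we have \[ \kappa^*_W=\min_{d>0}\kappa^d_W=\max\left\{\kappa_W(H)^{1/|H|}:\ H\text{ is a cycle in }G\right\}, \] where $G$ is the circuit ratio digraph of $W$. (In particular the minimum over $d\in\mathbb{R}^n_{++}$ is attained.)
   Context: For $C\subseteq[n]$ let $\mathbb{R}^n_C=\{x\in\mathbb{R}^n:x_{[n]\setminus C}=0\}$. A circuit of the linear subspace $W\subseteq\mathbb{R}^n$ is a set $C\subseteq[n]$ such that $W\cap\mathbb{R}^n_C$ is one-dimensional and no strict subset of $C$ has this property. $\mathcal C_W$ is the set of circuits. To each $C\in\mathcal C_W$ belongs a vector $g^C\in W$ with $\mathrm{supp}(g^C)=C$, unique up to scalar multiplication. For $i,j\in[n]$, \[ \kappa^W_{ij}=\max\left\{\frac{|g^C_j|}{|g^C_i|}:C\in\mathcal C_W,\ i,j\in C\right\}, \] with $\kappa^W_{ij}=0$ if there is no circuit containing $i$ and $j$. The circuit imbalance measure is $\kappa_W=\max\{\kappa^W_{ij}:i,j\in[n]\}$. For $d\in\mathbb{R}^n_{++}$, $\kappa^d_W=\kappa_{\mathrm{Diag}(d)W}$, where $\mathrm{Diag}(d)W=\{(d_ix_i)_i:x\in W\}$. $\kappa^*_W=\min\{\kappa_{DW}:D\text{ a positive }n\times n\text{ diagonal matrix}\}$. The circuit ratio digraph $G=([n],E)$ has $(i,j)\in E$ iff $\kappa^W_{ij}>0$ (loops $i=j$ included). A cycle $H$ in $G$ is a sequence of indices $i_1,i_2,\dots,i_k,i_{k+1}=i_1$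 with $(i_j,i_{j+1})\in E$; its length is $|H|=k$, and $\kappa_W(H)=\prod_{j=1}^k\kappa^W_{i_ji_{j+1}}$. A maximum over the empty set (which occurs only for $W=\{0\}$) is read as $0$. *)

(* Defs.v *)
From HB Require Import structures.
From mathcomp Require Import all_boot all_order all_algebra.
From mathcomp Require Import all_classical all_reals all_analysis.

Set Implicit Arguments.
Unset Strict Implicit.
Unset Printing Implicit Defensive.

Import Order.TTheory GRing.Theory Num.Theory.
Local Open Scope classical_set_scope.
Local Open Scope ring_scope.

Section CircuitImbalance.
Variables (R : realType) (n : nat).
Implicit Types (W : {vspace 'cV[R]_n}) (C : {set 'I_n}) (x : 'cV[R]_n).

Definition supp x : {set 'I_n} := [set i | x i 0 != 0].

(* R^n_C as the kernel of the coordinate projection onto [n] \ C; see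
   [memv_coordv]. *)
Definition coordv C : {vspace 'cV[R]_n} :=
  lker (linfun (mulmx (diag_mx (\row_i (i \notin C)%:R)))).

Lemma memv_coordv C x :
  (x \in coordv C) = [forall (i | i \notin C), x i 0 == 0].
Proof.
rewrite memv_ker lfunE /=; apply/eqP/forall_inP => [h i iC|h].
  move/matrixP: h => /(_ i 0).
  by rewrite mul_diag_mx !mxE iC mul1r => ->.
apply/matrixP => i j; rewrite mul_diag_mx !mxE ord1.
by case: (boolP (i \in C)) => iC; rewrite ?mul0r // (eqP (h i iC)) mulr0.
Qed.

Lemma memv_coordv_supp C x : (x \in coordv C) = (supp x \subset C).
Proof.
rewrite memv_coordv; apply/forall_inP/fintype.subsetP => [h i|h i iC].
  by rewrite inE; apply: contraR => /h.
by apply: contraR iC => xi; apply: h; rewrite inE.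
Qed.

Definition circuit W C : bool :=
  (\dim (W :&: coordv C) == 1)%N &&
  [forall D : {set 'I_n}, (D \proper C) ==> (\dim (W :&: coordv D) != 1)%N].

(* The vector g^C of a circuit C: an arbitrary nonzero element of the line
   W :&: coordv C.  [supp_circuit_vec] and [circuit_vec_uniq] show that it has
   support C and is unique up to scaling, so the ratios below do not depend on
   the choice. *)
Definition circuit_vec W C : 'cV[R]_n := vpick (W :&: coordv C).

Lemma circuit_vec_mem W C : circuit_vec W C \in W.
Proof. by have := memv_pick (W :&: coordv C)%VS; rewrite memv_cap => /andP[]. Qed.

Lemma supp_circuit_vec W C : circuit W C -> supp (circuit_vec W C) = C.
Proof.
case/andP => /eqP d1 /forallP minC.
have gU := memv_pick (W :&: coordv C)%VS.
have gn0 : circuit_vec W C != 0 by rewrite vpick0 -dimv_eq0 d1.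
have sC : supp (circuit_vec W C) \subset C.
  by move: gU; rewrite memv_cap memv_coordv_supp => /andP[].
apply/eqP; rewrite eqEproper sC /=; apply/negP => pC.
have /implyP/(_ pC)/negP := minC (supp (circuit_vec W C)); apply.
rewrite eqn_leq; apply/andP; split.
  apply: leq_trans (eq_leq d1); apply: dimvS; apply: capvS => //.
  apply/subvP => y; rewrite !memv_coordv_supp => /fintype.subset_trans; exact.
rewrite lt0n dimv_eq0; apply: contraNneq gn0 => U0.
by rewrite -memv0 -U0 memv_cap circuit_vec_mem memv_coordv_supp subxx.
Qed.

Lemma circuit_vec_uniq W C x : circuit W C -> x \in W -> supp x = C ->
  exists c : R, x = c *: circuit_vec W C.
Proof.
case/andP => /eqP d1 _ xW sx.
have gn0 : circuit_vec W C != 0 by rewrite vpick0 -dimv_eq0 d1.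
have /eqP eqU : (<[circuit_vec W C]> == W :&: coordv C)%VS.
  by rewrite eqEdim -memvE memv_pick d1 dim_vline gn0.
by apply/vlineP; rewrite eqU memv_cap xW memv_coordv_supp sx subxx.
Qed.

Definition kappa_ij W (i j : 'I_n) : R :=
  \big[Num.max/0]_(C : {set 'I_n} | [&& circuit W C, i \in C & j \in C])
    (`|circuit_vec W C j 0| / `|circuit_vec W C i 0|).

Definition kappa W : R := \big[Num.max/0]_i \big[Num.max/0]_j kappa_ij W i j.

Definition mx_image (D : 'M[R]_n) W : {vspace 'cV[R]_n} :=
  (linfun (mulmx D) @: W)%VS.

Definition pos_vec : set 'rV[R]_n := [set d : 'rV[R]_n | forall i, 0 < d 0 i].

Definition pos_diag_mx : set 'M[R]_n :=
  [set D : 'M[R]_n | is_diag_mx D /\ forall i, 0 < D i i].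

Definition kappa_d W (d : 'rV[R]_n) : R := kappa (mx_image (diag_mx d) W).

(* Stated as an infimum; its attainment has to be asserted separately, with
   [is_min]. *)
Definition kappa_star W : R :=
  inf [set kappa (mx_image D W) | D in pos_diag_mx].

Definition ratio_edge W : rel 'I_n := fun i j => 0 < kappa_ij W i j.

(* A cycle i_1, ..., i_k, i_(k+1) = i_1 is the sequence [:: i_1; ...; i_k],
   k >= 1; vertices may repeat, and [:: i] is a loop. *)
Definition ratio_cycle W : set (seq 'I_n) :=
  [set H : seq 'I_n | (H != [::]) && cycle (ratio_edge W) H].

Definition kappa_cycle W (H : seq 'I_n) : R :=
  \prod_(p <- zip H (rot 1 H)) kappa_ij W p.1 p.2.

End CircuitImbalance.

Definition is_min (R : realType) (A : set R) (m : R) : Prop :=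
  A m /\ lbound A m.

(* The maximum of the empty set is 0. *)
Definition is_max (R : realType) (A : set R) (m : R) : Prop :=
  (A = set0 /\ m = 0) \/ (A m /\ ubound A m).

(* Main.v *)
Require Import Defs.
From HB Require Import structures.
From mathcomp Require Import all_boot all_order all_algebra.
From mathcomp Require Import all_classical all_reals all_analysis.

Set Implicit Arguments.
Unset Strict Implicit.
Unset Printing Implicit Defensive.

Import Order.TTheory GRing.Theory Num.Theory.
Local Open Scope classical_set_scope.
Local Open Scope ring_scope.

(** Rescaling by [d] multiplies [kappa_ij W i j] by [d_j / d_i]
    ([kappa_ij_diag]): the circuits do not change, and the circuit vectors are
    rescaled coordinatewise up to a common factor.  Along a cycle these factors
    telescope to [1], so every cycle product is invariant, and its geometric
    mean cannot exceed the largest ratio of any rescaling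
    ([cycle_mean_le_kappa_d]).

    For the converse, if the digraph has a cycle, let [t] be the largest
    geometric mean of a simple cycle.
    After division of all ratios by [t], simple cycles have product at most
    [1], and the logarithms of the inverse ratios are edge lengths without
    negative cycles.  A shortest-path potential, in multiplicative form
    ([exists_potential]), is then a vector [d] with
    [kappa_ij W i j * d_j / d_i <= t] for all [i] and [j]
    ([exists_rescaling]).  Hence [t] is at once an attained minimum over the
    rescalings and, by the first half applied to this [d], a maximum over all
    cycles, simple or not.

    Pairs that are not edges have ratio [0].  Allowing them as steps of weight
    [0] turns every sequence of vertices into a walk, so that paths in the ratio
    digraph need not be tracked. *)

(** * Multiplicative potentials on a weighted digraph *)

Section Walks.
Variable R : realType.

Definition walk_weight (T : Type) (w : T -> T -> R) (x : T) (s : seq T) : R :=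
  \prod_(c <- pairmap w x s) c.

Section WalkWeight.
Variables (T : Type) (w : T -> T -> R).

Lemma walk_weight_cons x y s :
  walk_weight w x (y :: s) = w x y * walk_weight w y s.
Proof. by rewrite /walk_weight /= big_cons. Qed.

Lemma walk_weight_cat x s1 s2 :
  walk_weight w x (s1 ++ s2) = walk_weight w x s1 * walk_weight w (last x s1) s2.
Proof. by rewrite /walk_weight pairmap_cat big_cat. Qed.

Lemma walk_weight_zip x s z :
  \prod_(p <- zip (x :: s) (rcons s z)) w p.1 p.2 =
  walk_weight w x (rcons s z).
Proof.
elim: s x => [|y s IH] x; rewrite /= walk_weight_cons big_cons /=.
  by rewrite /walk_weight !big_nil.
by rewrite -IH.
Qed.

Hypothesis w_ge0 : forall i j, 0 <= w i j.

Lemma walk_weight_ge0 x s : 0 <= walk_weight w x s.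
Proof.
elim: s x => [|y s IH] x; first by rewrite /walk_weight big_nil.
by rewrite walk_weight_cons mulr_ge0.
Qed.

Lemma path_walk_weight_gt0 x s :
  path (fun i j => 0 < w i j) x s = (0 < walk_weight w x s).
Proof.
elim: s x => [|y s IH] x; first by rewrite /walk_weight big_nil ltr01.
rewrite walk_weight_cons /= IH; case: (ltgtP (w x y) 0) => [||->] /=.
- by rewrite ltNge w_ge0.
- by move=> wxy; rewrite pmulr_rgt0.
- by rewrite mul0r ltxx.
Qed.

Lemma walk_weight_le_exp (t : R) x s : (forall i j, w i j <= t) ->
  walk_weight w x s <= t ^+ size s.
Proof.
move=> wt; elim: s x => [|y s IH] x; first by rewrite /walk_weight big_nil.
by rewrite walk_weight_cons exprS ler_pM ?walk_weight_ge0.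
Qed.

End WalkWeight.

Lemma walk_weight_scale (T : Type) (w : T -> T -> R) (c : R) x s :
  walk_weight (fun i j => w i j * c) x s = walk_weight w x s * c ^+ size s.
Proof.
elim: s x => [|y s IH] x; first by rewrite /walk_weight !big_nil mulr1.
by rewrite !walk_weight_cons IH /= exprS mulrACA.
Qed.

(** Along a walk the factors contributed by a potential telescope; on a closed
    walk they cancel, which is why cycle products are rescaling invariants. *)
Lemma walk_weight_rescale (T : Type) (w : T -> T -> R) (p : T -> R) x s :
  (forall i, 0 < p i) ->
  walk_weight (fun i j => w i j * (p j / p i)) x s =
  walk_weight w x s * (p (last x s) / p x).
Proof.
move=> p0; elim: s x => [|y s IH] x.
  by rewrite /walk_weight !big_nil mul1r divff ?gt_eqF.
rewrite !walk_weight_cons IH mulrACA; congr (_ * _).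
by rewrite mulrC mulrA divfK ?gt_eqF.
Qed.

(** Duplicate-free sequences over a finite type have bounded length, so there
    are finitely many of them. *)
Lemma uniq_seq_max (T : finType) (P : pred (seq T)) (F : seq T -> R) s0 :
  (forall s, P s -> uniq s) -> P s0 ->
  exists2 s, P s & forall s', P s' -> F s' <= F s.
Proof.
move=> Puniq Ps0.
have sz s : P s -> (size s <= #|T|)%N.
  by move=> /Puniq /card_uniqP <-; apply: max_card.
pose b0 : #|T|.-bseq T := Bseq (sz _ Ps0).
have [b Pb bmax] := @arg_maxP _ R _ b0 (fun b => P b) (fun b => F b) Ps0.
by exists b => // s Ps; apply: (bmax (Bseq (sz _ Ps))).
Qed.

(** This is the multiplicative form of the existence of shortest-path
    potentials in a digraph without negative cycles: [p i] is the largest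
    weight of a simple path starting at [i].  Prepending an edge [(i, j)] to an
    optimal path from [j] either gives a simple path from [i], or closes a
    simple cycle through [i]; deleting that cycle, whose weight is at most [1],
    leaves a simple path from [i] of no smaller weight. *)
Lemma exists_potential (T : finType) (w : T -> T -> R) :
  (forall i j, 0 <= w i j) ->
  (forall x s, uniq (x :: s) -> walk_weight w x (rcons s x) <= 1) ->
  exists2 p : T -> R, (forall i, 0 < p i) & forall i j, w i j * p j <= p i.
Proof.
move=> w0 wc.
have best i : exists s, uniq (i :: s) /\
    forall s', uniq (i :: s') -> walk_weight w i s' <= walk_weight w i s.
  have [|s us smax] := @uniq_seq_max T [pred s | uniq (i :: s)]
    (walk_weight w i) [::] _ isT; last by exists s; split.
  by move=> s /andP[].
have [b bP] := choice best.
exists (fun i => walk_weight w i (b i)) => [i|i j].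
  apply: lt_le_trans ltr01 _; rewrite -[leLHS](big_nil 1 *%R xpredT id).
  exact: (proj2 (bP i) [::]).
rewrite -walk_weight_cons; have [ubj _] := bP j.
case: (boolP (i \in j :: b j)) => [|nin]; last first.
  by apply: (proj2 (bP i)); rewrite cons_uniq nin.
move: (j :: b j) ubj => s us /splitPr s_split.
case: s_split us => s1 s2; rewrite -cat_rcons cat_uniq => /and3P[us1 nhas us2].
rewrite walk_weight_cat last_rcons.
apply: (le_trans (y := walk_weight w i s2)).
  by apply: ler_piMl; [exact: walk_weight_ge0|apply: wc; rewrite /= -rcons_uniq].
apply: (proj2 (bP i)); rewrite /= us2 andbT.
by apply: contra nhas => i2; apply/hasP; exists i; rewrite // mem_rcons mem_head.
Qed.

Lemma powR_root_le (a t : R) (k : nat) : 0 <= a -> 0 <= t -> (0 < k)%N ->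
  (a `^ k%:R^-1 <= t) = (a <= t ^+ k).
Proof.
move=> a0 t0 k0.
rewrite -[a in RHS]powRr1 // -[1 in RHS](@mulVf _ k%:R) ?pnatr_eq0 -?lt0n //.
by rewrite powRrM powR_mulrn ?powR_ge0 // ler_pXn2r // nnegrE powR_ge0.
Qed.

End Walks.

(** * Circuit ratios under positive diagonal rescaling *)

Section Rescaling.
Variables (R : realType) (n : nat).
Implicit Types (W : {vspace 'cV[R]_n}) (C : {set 'I_n}) (d : 'rV[R]_n).

Lemma kappa_ij_ge0 W i j : 0 <= kappa_ij W i j.
Proof. exact: bigmax_ge_id. Qed.

Lemma kappa_ij_le_kappa W i j : kappa_ij W i j <= kappa W.
Proof.
apply: le_trans (le_bigmax 0 (fun i => \big[Num.max/0]_j kappa_ij W i j) i).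
exact: (le_bigmax 0 (fun j => kappa_ij W i j) j).
Qed.

Lemma kappa_le W (t : R) : 0 <= t -> (forall i j, kappa_ij W i j <= t) ->
  kappa W <= t.
Proof. by move=> t0 h; do 2![apply: bigmax_le => // ? _]. Qed.

Lemma kappa_cycle_walk W i s :
  kappa_cycle W (i :: s) = walk_weight (kappa_ij W) i (rcons s i).
Proof. by rewrite /kappa_cycle rot1_cons walk_weight_zip. Qed.

Lemma kappa_cycle_ge0 W H : 0 <= kappa_cycle W H.
Proof. by apply: prodr_ge0 => p _; apply: kappa_ij_ge0. Qed.

(** A circuit through [i] contributes the ratio [1] to [kappa_ij W i i].  So
    every tail of an edge carries a loop, and a digraph with an edge has a
    cycle. *)
Lemma kappa_ii_gt0 W i j : 0 < kappa_ij W i j -> 0 < kappa_ij W i i.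
Proof.
apply: contraTT; rewrite -!leNgt => kii; apply: bigmax_le => // C /and3P[cC iC _].
have := le_bigmax_cond 0
  (fun C => `|circuit_vec W C i 0| / `|circuit_vec W C i 0|)
  (P := fun C => [&& circuit W C, i \in C & i \in C]) (j := C).
rewrite cC iC => /(_ isT) /le_trans /(_ kii).
have : i \in supp (circuit_vec W C) by rewrite supp_circuit_vec.
by rewrite inE => gi; rewrite divff ?normr_eq0 // ler10.
Qed.

Lemma ratio_cycle_gt0 W H : ratio_cycle W H -> 0 < kappa_cycle W H.
Proof.
case: H => // i s /= ps.
by rewrite kappa_cycle_walk -path_walk_weight_gt0 //; exact: kappa_ij_ge0.
Qed.

Section Diagonal.
Variables (W : {vspace 'cV[R]_n}) (d : 'rV[R]_n).
Hypothesis d_gt0 : forall i, 0 < d 0 i.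

Local Notation f := (linfun (mulmx (diag_mx d)) : 'Hom('cV[R]_n, 'cV[R]_n)).

Lemma diag_mulE (x : 'cV[R]_n) i : f x i 0 = d 0 i * x i 0.
Proof. by rewrite lfunE /= mul_diag_mx mxE. Qed.

Lemma supp_diag x : supp (f x) = supp x.
Proof.
by apply/setP => i; rewrite !inE diag_mulE mulf_eq0 (gt_eqF (d_gt0 i)).
Qed.

Lemma lker_diag : lker f = 0%VS.
Proof.
apply/eqP/lker0P => x y /matrixP exy; apply/matrixP => i k; rewrite ord1.
by have := exy i 0; rewrite !diag_mulE => /mulfI -> //; rewrite gt_eqF.
Qed.

Lemma dim_diag_coordv C :
  \dim (mx_image (diag_mx d) W :&: coordv R C) = \dim (W :&: coordv R C).
Proof.
rewrite -[RHS](limg_dim_eq (f := f)) ?lker_diag ?capv0 //; congr (\dim _).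
apply/vspaceP => y; rewrite memv_cap memv_coordv_supp.
apply/andP/memv_imgP => [[/memv_imgP[x xW ->]]|[x]].
  by rewrite supp_diag => sx; exists x; rewrite // memv_cap xW memv_coordv_supp.
rewrite memv_cap memv_coordv_supp => /andP[xW sx] ->.
by rewrite supp_diag memv_img.
Qed.

Lemma circuit_diag C : circuit (mx_image (diag_mx d) W) C = circuit W C.
Proof.
rewrite /circuit dim_diag_coordv; congr (_ && _).
by apply: eq_forallb => D; rewrite dim_diag_coordv.
Qed.

(** The rescaled circuit vector is a multiple of the circuit vector of the
    rescaled subspace, and the multiple cancels in the ratio. *)
Lemma circuit_ratio_diag C i j : circuit W C -> i \in C ->
  `|circuit_vec (mx_image (diag_mx d) W) C j 0| /
  `|circuit_vec (mx_image (diag_mx d) W) C i 0| =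
  `|circuit_vec W C j 0| / `|circuit_vec W C i 0| * (d 0 j / d 0 i).
Proof.
move=> cC iC; set g := circuit_vec W C; set g' := circuit_vec _ C.
have sg : supp g = C by apply: supp_circuit_vec.
have [|||c fg] := @circuit_vec_uniq R n (mx_image (diag_mx d) W) C (f g).
- by rewrite circuit_diag.
- by apply: memv_img; apply: circuit_vec_mem.
- by rewrite supp_diag.
have E k : d 0 k * `|g k 0| = `|c| * `|g' k 0|.
  by rewrite -[d 0 k]gtr0_norm // -!normrM -diag_mulE fg mxE.
have gi : `|g i 0| != 0 by rewrite normr_eq0; move: iC; rewrite -sg inE.
have di : d 0 i != 0 by rewrite gt_eqF.
have : `|c| * `|g' i 0| != 0 by rewrite -E mulf_neq0.
rewrite mulf_eq0 negb_or => /andP[c0 g'i].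
by rewrite mulrACA -invfM ![_ * d 0 _]mulrC !E -mulf_div divff // mul1r.
Qed.

Lemma kappa_ij_diag i j :
  kappa_ij (mx_image (diag_mx d) W) i j = kappa_ij W i j * (d 0 j / d 0 i).
Proof.
have dd : 0 <= d 0 j / d 0 i by rewrite divr_ge0 // ltW.
rewrite /kappa_ij
  (@big_morph _ _ (fun x => x * (d 0 j / d 0 i)) 0 Num.max 0 Num.max);
  [|by move=> x y; rewrite maxr_pMl|by rewrite mul0r].
apply: eq_big => [C|C /and3P[cC iC _]]; first by rewrite circuit_diag.
by rewrite circuit_ratio_diag // -circuit_diag.
Qed.

Lemma kappa_cycle_diag H :
  kappa_cycle (mx_image (diag_mx d) W) H = kappa_cycle W H.
Proof.
case: H => [|i s]; first by rewrite /kappa_cycle !big_nil.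
rewrite !kappa_cycle_walk.
have := walk_weight_rescale (kappa_ij W) i (rcons s i) d_gt0.
rewrite last_rcons divff ?gt_eqF // mulr1 => <-.
congr (walk_weight _ _ _); apply/funext => k; apply/funext => l.
exact: kappa_ij_diag.
Qed.

End Diagonal.

(** Cycle products are rescaling invariants, and after any rescaling each
    factor of the product is at most [kappa_d W d]. *)
Lemma cycle_mean_le_kappa_d W d H : pos_vec d -> H != [::] ->
  kappa_cycle W H `^ (size H)%:R^-1 <= kappa_d W d.
Proof.
move=> d0; case: H => // i s _.
have k0 : 0 <= kappa_d W d by exact: bigmax_ge_id.
rewrite powR_root_le ?kappa_cycle_ge0 // -(kappa_cycle_diag W d0).
rewrite kappa_cycle_walk [size _]/= -(size_rcons s i).
apply: walk_weight_le_exp; [exact: kappa_ij_ge0|exact: kappa_ij_le_kappa].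
Qed.

Lemma kappa_star_eq W :
  kappa_star W = inf [set kappa_d W d | d in @pos_vec R n].
Proof.
congr inf; apply/seteqP; split=> [_ [D [dD D0] <-]|_ [d d0 <-]].
  exists (\row_i D i i) => [i|]; first by rewrite mxE.
  rewrite /kappa_d; congr (kappa (mx_image _ W)); apply/matrixP => i j.
  rewrite !mxE; case: eqP => [->|/eqP ij]; first by rewrite mulr1n.
  by rewrite mulr0n; move/is_diag_mxP: dD => ->.
exists (diag_mx d) => //; split; first exact: diag_mx_is_diag.
by move=> i; rewrite mxE eqxx mulr1n.
Qed.

Lemma kappa_star_attained W d : pos_vec d ->
  (forall e, pos_vec e -> kappa_d W d <= kappa_d W e) ->
  kappa_star W = kappa_d W d.
Proof.
move=> d0 dmin; rewrite kappa_star_eq.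
have lb : lbound [set kappa_d W d | d in @pos_vec R n] (kappa_d W d).
  by move=> _ [e e0 <-]; apply: dmin.
apply/eqP; rewrite eq_le; apply/andP; split.
  by apply: ge_inf; [exists (kappa_d W d)|exists d].
by apply: lb_le_inf => //; exists (kappa_d W d), d.
Qed.

(** If [t] bounds the geometric means of all simple cycles, the
    weights [kappa_ij W i j / t] have simple cycle products at most [1], and a
    potential for them is a rescaling with every ratio at most [t]. *)
Lemma exists_rescaling W (t : R) : 0 < t ->
  (forall i s, uniq (i :: s) -> kappa_cycle W (i :: s) <= t ^+ size (i :: s)) ->
  exists2 d, pos_vec d & kappa_d W d <= t.
Proof.
move=> t0 tH.
have [i j|i s us|p p0 pP] :=
  @exists_potential R 'I_n (fun i j => kappa_ij W i j * t^-1).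
- by rewrite divr_ge0 ?kappa_ij_ge0 // ltW.
- rewrite walk_weight_scale size_rcons exprVn ler_pdivrMr ?exprn_gt0 // mul1r.
  by rewrite -kappa_cycle_walk; apply: tH.
have d0 : pos_vec (\row_i p i) by move=> i; rewrite mxE.
exists (\row_i p i) => //; apply: kappa_le => [|i j]; first exact: ltW.
rewrite kappa_ij_diag // !mxE mulrA ler_pdivrMr // [t * _]mulrC.
by rewrite -ler_pdivrMr // mulrAC.
Qed.

End Rescaling.

(** * The characterization *)

Theorem theorem2p12 (R : realType) (n : nat) (W : {vspace 'cV[R]_n}) :
  is_min [set kappa_d W d | d in @pos_vec R n] (kappa_star W) /\
  is_max [set kappa_cycle W H `^ (size H)%:R^-1 | H in ratio_cycle W]
    (kappa_star W).
Proof.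
have [d d0 [cmax dmin]] : exists2 d, pos_vec d &
    is_max [set kappa_cycle W H `^ (size H)%:R^-1 | H in ratio_cycle W]
      (kappa_d W d) /\
    forall e, pos_vec e -> kappa_d W d <= kappa_d W e.
  have [[i [j kij]]|noedge] := pselect (exists i j, 0 < kappa_ij W i j).
    have kii := kappa_ii_gt0 kij.
    have [||H /andP[uH cH] Hmax] := @uniq_seq_max R 'I_n
      [pred H | uniq H && ((H != [::]) && cycle (ratio_edge W) H)]
      (fun H => kappa_cycle W H `^ (size H)%:R^-1) [:: i].
    - by move=> s /andP[].
    - by rewrite /= /ratio_edge kii.
    set t := _ `^ _ in Hmax.
    have t0 : 0 < t by apply: powR_gt0; apply: ratio_cycle_gt0.
    have [|d d0 dt] := @exists_rescaling R n W t t0.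
      move=> k s us; have [rc|nrc] := boolP (cycle (ratio_edge W) (k :: s)).
        rewrite -powR_root_le ?kappa_cycle_ge0 ?(ltW t0) //.
        by apply: Hmax; apply/and3P; split.
      (* A closed sequence that is not a cycle of the ratio digraph has a
         vanishing factor. *)
      have kc0 : kappa_cycle W (k :: s) <= 0.
        rewrite leNgt kappa_cycle_walk -path_walk_weight_gt0 //.
        exact: kappa_ij_ge0.
      by rewrite (le_trans kc0) // exprn_ge0 // ltW.
    have Hn0 : H != [::] by case/andP: cH.
    have dE : kappa_d W d = t.
      by apply/eqP; rewrite eq_le dt cycle_mean_le_kappa_d.
    exists d => //; rewrite dE; split; last first.
      by move=> e e0; apply: cycle_mean_le_kappa_d.
    right; split; first by exists H.
    by move=> _ [K /andP[K0 _] <-]; rewrite -dE; apply: cycle_mean_le_kappa_d.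
  (* Without edges there are no cycles and every rescaling has measure 0. *)
  have kappa0 i j : kappa_ij W i j = 0.
    apply/eqP; rewrite eq_le kappa_ij_ge0 leNgt andbT.
    by apply/negP => kij; apply: noedge; exists i, j.
  have d0 : pos_vec (const_mx 1 : 'rV[R]_n) by move=> i; rewrite mxE.
  exists (const_mx 1) => //.
  have -> : kappa_d W (const_mx 1) = 0.
    apply/eqP; rewrite eq_le bigmax_ge_id andbT; apply: kappa_le => // i j.
    by rewrite kappa_ij_diag // kappa0 mul0r.
  split; last by move=> e _; apply: bigmax_ge_id.
  left; split=> //; apply/seteqP; split=> // x [[|i s] // rc _].
  have := ratio_cycle_gt0 rc; rewrite kappa_cycle_walk.
  by case: s {rc} => [|j s]; rewrite /= walk_weight_cons kappa0 mul0r ltxx.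
rewrite (kappa_star_attained d0 dmin); split=> //; split; first by exists d.
by move=> _ [e e0 <-]; apply: dmin.
Qed.
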